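(* Let $E$ be a Banach space (with norm $\|\cdot\|$) of analytic functions on the unit disc $\mathbb D$ such that the polynomials are dense and the point evaluations are $L^1$-average continuous. Let $0\le r_0<1$ and let $\phi:[r_0,1)\to(0,\infty)$ be an increasing continuous function with $\lim_{r\to1}\phi(r)=\infty$. Assume further that there exist $f\in E$ and a sequence $r_p\to 1$ (with $r_0\le r_p<1$) for which $$\lim_{p\to\infty}\frac{1}{\phi(r_p)}\min\{|f(r_pe^{i\theta})|:e^{i\theta}\in\mathbb T\}=\infty.$$ Then the set $$\Big\{g\in E:\ \Big|\Big\{e^{i\theta}\in\mathbb T:\limsup_{r\to1}\frac{1}{\phi(r)}|g(re^{i\theta})|=\infty\Big\}\Big|=1\Big\}$$ is a residual set in $E$.
   Context: $\mathbb D=\{z\in\mathbb C:|z|<1\}$ and $\mathbb T$ is the unit circle. $dm(\theta)=\frac{1}{2\pi}d\theta$ is normalized Lebesgue measure on $\mathbb T$, and $|F|$ denotes the measure of a measurable set $F\subset\mathbb T$ (so $|\mathbb T|=1$). $E$ is a complex vector space of analytic functions on $\mathbb D$, complete under $\|\cdot\|$. ''The polynomials are dense'' means that $E$ contains all (complex) polynomials and they form a dense subset of $E$. The point evaluations are called $L^1$-average continuous on $E$ if there is $\rho_0\in[0,1)$ such that for every $r$ with $\rho_0\le r<1$ there is a positive real constant $C(r)$ with $$\int_0^{2\pi}|h(re^{i\theta})|\,dm(\theta)\le C(r)\|h\|\quad\text{for all }h\in E.$$ Limits $r\to1$ are taken with $r<1$. A residual set is a set containing a dense $G_\delta$ set,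 a $G_\delta$ set being a countable intersection of open sets. *)

(* Defs.v *)
From HB Require Import structures.
From mathcomp Require Import all_boot all_order all_algebra.
From mathcomp Require Import all_classical all_reals all_analysis.
From mathcomp Require Import complex borel_hierarchy.

Set Implicit Arguments.
Unset Strict Implicit.
Unset Printing Implicit Defensive.

Import Order.TTheory GRing.Theory Num.Theory.
Import numFieldNormedType.Exports.
Export Normc.

Local Open Scope classical_set_scope.
Local Open Scope ring_scope.
Local Open Scope complex_scope.

Section Disc.
Context {R : realType}.

Definition unit_disc : set R[i] := [set z | `|z| < 1].

Definition unit_circle : set R[i] := [set z | `|z| = 1].

Definition expi (t : R) : R[i] := cos t +i* sin t.

(* Functions on the disc are represented by total functions on R[i]; their
   values outside the disc are irrelevant.  [R[i]^o] is R[i] seen as a normed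
   module over itself, so this is complex differentiability. *)
Definition analytic_on_disc (f : R[i] -> R[i]) : Prop :=
  forall z, unit_disc z -> derivable (f : R[i]^o -> R[i]^o) z 1.

(* dm = dt / 2 pi on [0, 2 pi] *)
Definition circle_mean (u : R -> R) : \bar R :=
  (((2 * pi)^-1)%R%:E *
   \int[lebesgue_measure]_(t in `[0%R, (2 * pi)%R]) (u t)%:E)%E.

Definition circle_measure (F : set R[i]) : \bar R :=
  (((2 * pi)^-1)%R%:E * lebesgue_measure (`[0%R, (2 * pi)%R[ `&` expi @^-1` F))%E.

Definition is_minimum (A : set R) (m : R) : Prop := A m /\ lbound A m.

(* The norm of a module over R[i] takes its values in R[i], in fact among the
   nonnegative reals, so this loses no information. *)
Definition real_norm (E : normedModType R[i]) (g : E) : R := complex.Re `|g|.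

End Disc.

Section AnalyticFunctionSpace.
Context {R : realType} (E : completeNormedModType R[i]).

(* E is a space of functions through [ev]: [ev g z] is the value of g at z.  The
   second clause says that an element of E is determined by its values on the
   disc, i.e. that it is a function on the disc. *)
Definition analytic_function_space (ev : E -> R[i] -> R[i]) : Prop :=
  [/\ forall (a : R[i]) (g h : E) z, unit_disc z ->
        ev (a *: g + h) z = a * ev g z + ev h z,
      forall g h : E, (forall z, unit_disc z -> ev g z = ev h z) -> g = h
    & forall g : E, analytic_on_disc (ev g)].

Definition represents_poly (ev : E -> R[i] -> R[i]) (p : {poly R[i]}) (g : E) :=
  forall z, unit_disc z -> ev g z = p.[z].

Definition polynomials_dense (ev : E -> R[i] -> R[i]) : Prop :=
  (forall p, exists g, represents_poly ev p g) /\
  dense [set g | exists p, represents_poly ev p g].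

Definition L1_average_continuous (ev : E -> R[i] -> R[i]) : Prop :=
  exists2 rho0 : R, 0 <= rho0 < 1 &
    forall r : R, rho0 <= r < 1 ->
      exists2 C : R, 0 < C &
        forall h : E,
          (circle_mean (fun t => normc (ev h (r%:C * expi t)))%R
             <= (C * real_norm h)%:E)%E.

End AnalyticFunctionSpace.

Definition residual (T : topologicalType) (A : set T) : Prop :=
  exists2 B : set T, Gdelta B /\ dense B & B `<=` A.

(* Main.v *)
(* Let V_n be the set of g in E for which some radius r > 1 - 1/(n+1) satisfies
   |g(r e^it)| > n phi(r) outside a set of t of measure at most 1/(n+1).  If g
   lies in every V_n, then the intersections of the tails of these exceptional
   sets are null, so the limsup is infinite at almost every point of the circle.
   If q is a polynomial and e > 0, then |q + e f| exceeds (n + 1) phi on an entire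
   circle of radius r_p, since phi(r_p) eventually dominates q; by Chebyshev's
   inequality and L^1-average continuity a whole ball around q + e f is contained
   in V_n.  Hence the interiors of the V_n are dense, and Baire's theorem
   applies. *)
Require Import Defs.
From HB Require Import structures.
From mathcomp Require Import all_boot all_order all_algebra.
From mathcomp Require Import all_classical all_reals all_analysis.
From mathcomp Require Import complex borel_hierarchy measurable_realfun.
From mathcomp Require Import ring lra zify.

Set Implicit Arguments.
Unset Strict Implicit.
Unset Printing Implicit Defensive.

Import Order.TTheory GRing.Theory Num.Theory.
Import numFieldNormedType.Exports.

Local Open Scope classical_set_scope.
Local Open Scope ring_scope.
Local Open Scope complex_scope.

(** * Baire's theorem for complex scalars *)

(** A positive element of [R[i]] has zero imaginary part, so the Archimedean property of [R]
    applies. Radii of balls are such elements below. *)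
Lemma complex_gt0_inv_nat (R : realType) (e : R[i]) :
  0 < e -> exists n : nat, n.+1%:R^-1 < e.
Proof.
rewrite ltcE/= => /andP[/eqP ime ree]; exists (Num.truncn (complex.Re e)^-1).
have : ((Num.truncn (complex.Re e)^-1).+1%:R)^-1 < complex.Re e.
  by rewrite -ltf_pV2 ?(posrE,invr_gt0)// invrK truncnS_gt.
rewrite -ltcR fmorphV/= rmorph_nat => /lt_le_trans; apply.
by rewrite lecE/= ime eqxx lexx.
Qed.

(* The library states Baire's theorem for real scalars only. *)
Lemma baire_complex (R : realType) (T : completePseudoMetricType R[i])
    (F : (set T)^nat) :
  (forall n, open (F n)) -> (forall n, dense (F n)) -> dense (\bigcap_n F n).
Proof.
move=> oF dF D D0 oD.
(* The radius of [y] is doubled because the limit of the centres is only known to lie in the doubled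
   balls; these must still sit in the previous ball and in [F n]. *)
pose shrinks n (x y : T * {posnum R[i]}) :=
  ball y.1 (2 * y.2%:num) `<=` ball x.1 x.2%:num `&` F n /\
  y.2%:num <= n.+1%:R^-1.
have shrink n x : exists y, shrinks n x y.
  have [//||a [xa Fa]] := dF n (ball x.1 x.2%:num)^°; [|exact: open_interior|].
    by exists x.1; exact: nbhsx_ballx.
  have /nbhs_ballP[e /= e0 ae] : nbhs a (ball x.1 x.2%:num `&` F n).
    by apply: filterI; [exact: xa|exact: open_nbhs_nbhs].
  have [m me] := complex_gt0_inv_nat e0.
  (* This radius is at most 1/(n+1), and its double at most 1/(m+1) < e. *)
  have d0 : 0 < (n.+1 + m.+1 + m.+1)%:R^-1 :> R[i].
    by rewrite invr_gt0 ltr0n addnS.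
  exists (a, PosNum d0); split => /=.
    apply: subset_trans ae; apply: le_ball; apply: le_trans (ltW me).
    rewrite ler_pdivrMr ?ltr0n ?addnS// mulrC ler_pdivlMr ?ltr0n//.
    by rewrite -natrM ler_nat; lia.
  by rewrite lef_pV2 ?posrE ?ltr0n ?addnS// ler_nat; lia.
have [a0 Da0] := D0.
have /nbhs_ballP[e /= e0 a0e] : nbhs a0 D by exact: open_nbhs_nbhs.
(* Half of [e], so that the doubled initial ball stays inside [D]. *)
have h0 : 0 < e / 2 by rewrite divr_gt0.
have /choice[next nextP] : forall nx : nat * (T * {posnum R[i]}),
    exists y, shrinks nx.1 nx.2 y.
  by move=> [n x]; exact: shrink.
pose fix a n := if n is m.+1 then next (m, a m) else (a0, PosNum h0).
have aS n : shrinks n (a n) (a n.+1) by exact: (nextP (n, a n)).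
have ball_dbl (x : T * {posnum R[i]}) :
    ball x.1 x.2%:num `<=` ball x.1 (2 * x.2%:num).
  by apply: le_ball; rewrite ler_peMl// ler1n.
have nested n k :
    ball (a (k + n)%N).1 (a (k + n)%N).2%:num `<=` ball (a n).1 (a n).2%:num.
  elim: k => [//|k IH]; apply: subset_trans IH.
  apply: subset_trans (ball_dbl _) _.
  by have [+ _] := aS (k + n)%N; rewrite subsetI => -[].
have mem n m : (n <= m)%N -> ball (a n).1 (a n).2%:num (a m).1.
  by move=> /subnK <-; apply: nested; exact: ballxx.
have : cvg ((fun n => (a n).1) @ \oo).
  apply: cauchy_cvg; apply: cauchy_exP => d d0.
  have [n nd] := complex_gt0_inv_nat d0.
  exists (a n.+1).1; exists n.+1 => // m /= nm.
  apply: le_ball (mem _ _ nm); apply: le_trans (ltW nd).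
  by have [_] := aS n.
move=> /cvg_ex[/= l al].
have lmem n : ball (a n).1 (2 * (a n).2%:num) l.
  have /cvg_ballP/(_ (a n).2%:num) := al.
  move=> /(_ (gt0 _)) [N _ /(_ (maxn N n) (leq_maxl _ _))] /= /ball_sym lb.
  rewrite mulr_natl mulr2n; apply: ball_triangle lb.
  exact: mem (leq_maxr _ _).
exists l; split.
  by apply: a0e; have := lmem 0%N; rewrite /= mulrC divfK.
by move=> n _; have [+ _] := aS n; move=> /(_ _ (lmem n.+1)) [].
Qed.

(** * The modulus on circles inside the disc *)

Lemma normc_ge0 (R : rcfType) (z : R[i]) : 0 <= normc z.
Proof. by case: z => x y; exact: sqrtr_ge0. Qed.

Lemma norm_normc (R : rcfType) (z : R[i]) : `|z| = (normc z)%:C.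
Proof. by []. Qed.

Lemma normc_real (R : rcfType) (x : R) : normc x%:C = `|x|.
Proof. by rewrite /= expr0n addr0 sqrtr_sqr. Qed.

Lemma normc_expi (R : realType) (t : R) : normc (expi t) = 1.
Proof. by rewrite /= cos2Dsin2 sqrtr1. Qed.

Lemma normc_circle (R : realType) (r t : R) :
  0 <= r -> normc (r%:C * expi t) = r.
Proof. by move=> r0; rewrite normcM normc_expi normc_real mulr1 ger0_norm. Qed.

Lemma unit_disc_circle (R : realType) (r t : R) :
  0 <= r < 1 -> unit_disc (r%:C * expi t).
Proof.
by move=> /andP[r0 r1]; rewrite /unit_disc/= norm_normc normc_circle// ltcR.
Qed.

Lemma ler_dist_normc (R : rcfType) (z w : R[i]) :
  `|normc z - normc w| <= normc (z - w).
Proof.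
have B (x y : R[i]) : normc x - normc y <= normc (x - y).
  by rewrite lerBlDr; have := le_normcD (x - y) y; rewrite subrK.
by rewrite ler_norml B lerNl opprB andbT -(normcN (z - w)) opprB B.
Qed.

Lemma continuous_expi (R : realType) : continuous (expi : R -> R[i]^o).
Proof.
move=> t; apply/cvgrPdist_lt => e; rewrite ltcE/= => /andP[/eqP ime ree].
have e2 : 0 < complex.Re e / 2 by rewrite divr_gt0.
have /cvgrPdist_lt/(_ _ e2) ct := @continuous_cos R t.
have /cvgrPdist_lt/(_ _ e2) st := @continuous_sin R t.
near=> s.
have -> : expi t - expi s = (cos t - cos s)%:C + 'i%C * (sin t - sin s)%:C.
  by rewrite [LHS]complexE.
rewrite norm_normc ltcE; apply/andP; split; first by rewrite /= ime.
apply: le_lt_trans (le_normcD _ _) _.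
rewrite normcM !normc_real [normc 'i%C]/= expr0n expr1n add0r sqrtr1 mul1r.
rewrite [ltRHS]splitr; apply: ltrD; near: s; [exact: ct|exact: st].
Unshelve. all: by end_near. Qed.

Lemma continuous_circle (R : realType) (f : R[i] -> R[i]) (r : R) :
  analytic_on_disc f -> 0 <= r < 1 ->
  continuous (fun t : R => normc (f (r%:C * expi t))).
Proof.
move=> af r01 t.
have cf : {for r%:C * expi t, continuous (f : R[i]^o -> R[i]^o)}.
  by apply/differentiable_continuous/derivable1_diffP/af/unit_disc_circle.
have : (f (r%:C * expi s) : R[i]^o) @[s --> t] --> (f (r%:C * expi t) : R[i]^o).
  apply: (continuous_comp _ cf).
  apply: (@continuous_comp _ _ _ (expi : R -> R[i]^o)
    (fun z : R[i]^o => r%:C * z : R[i]^o)); first exact: continuous_expi.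
  exact: mulrl_continuous.
move=> /cvgrPdist_lt fc; apply/cvgrPdist_lt => e e0.
have e0' : 0 < e%:C by rewrite ltcR.
near=> s.
apply: le_lt_trans (ler_dist_normc _ _) _.
by rewrite -ltcR -norm_normc; near: s; exact: fc.
Unshelve. all: by end_near. Qed.

(** * Outer measure, upper limits and Chebyshev's inequality *)

(* [lebesgue_measure] takes the value of the outer measure on arbitrary sets, so
   this and the two next lemmas require no measurability. *)
Lemma le_lebesgue_measure (R : realType) (A B : set R) :
  A `<=` B -> (lebesgue_measure A <= lebesgue_measure B)%E.
Proof. exact: (le_outer_measure (mu_ext (wlength idfun))). Qed.

Lemma lebesgue_measureU (R : realType) (A B : set R) :
  (lebesgue_measure (A `|` B) <= lebesgue_measure A + lebesgue_measure B)%E.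
Proof. exact: (outer_measureU2 (mu_ext (wlength idfun))). Qed.

Lemma lebesgue_measure_bigcup0 (R : realType) (A : (set R)^nat) :
  (forall n, lebesgue_measure (A n) = 0%E) ->
  lebesgue_measure (\bigcup_n A n) = 0%E.
Proof.
move=> A0; apply/eqP; rewrite eq_le; apply/andP; split.
  apply: le_trans (outer_measure_sigma_subadditive (mu_ext (wlength idfun)) A) _.
  by rewrite eseries0// => n _ _; exact: A0.
by have := @le_lebesgue_measure R set0 (\bigcup_n A n); rewrite measure0; apply.
Qed.

(** Since [x n] tends to [a] from the left, each left neighbourhood of [a] contains points [x n]
    with [u (x n)] at least n for arbitrarily large n. *)
Lemma limf_esup_at_left_pinfty (R : realType) (a : R) (u : R -> R)
    (x : nat -> R) :
  (forall n, a - n.+1%:R^-1 < x n < a) ->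
  (forall m, exists2 n, (m <= n)%N & n%:R <= u (x n)) ->
  limf_esup (fun r => (u r)%:E) a^'- = +oo%E.
Proof.
move=> xa ux; rewrite limf_esupE; apply/eqP; rewrite eq_le leey/=.
apply: le_ereal_inf_tmp => _ [V [e /= e0 Ve] <-].
rewrite leye_eq; apply/eqP/eqyP => M M0.
(* The first entry forces n > M, the second 1/(n+1) < e. *)
pose m := maxn (Num.truncn M).+1 (Num.truncn e^-1).
have [n mn un] := ux m.
apply: (@le_trans _ _ (u (x n))%:E).
  rewrite lee_fin; apply: le_trans un; apply/ltW.
  apply: lt_le_trans (truncnS_gt M) _; rewrite ler_nat.
  by apply: leq_trans mn; rewrite leq_maxl.
apply: ereal_sup_ubound; exists (x n) => //; apply: Ve; last by case/andP: (xa n).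
have /andP[xl xr] := xa n.
rewrite /ball_/= gtr0_norm ?subr_gt0//.
apply: (@lt_trans _ _ n.+1%:R^-1); first by rewrite ltrBlDr -ltrBlDl.
rewrite -[ltRHS]invrK ltf_pV2 ?posrE ?invr_gt0//.
apply: lt_le_trans (truncnS_gt _) _; rewrite ler_nat ltnS.
by apply: leq_trans mn; rewrite leq_maxr.
Qed.

(** The factor 2 pi undoes the normalization in [circle_mean], since the left side is plain Lebesgue
    measure in t. *)
Lemma circle_chebyshev (R : realType) (f : R[i] -> R[i]) (r a : R) :
  analytic_on_disc f -> 0 <= r < 1 -> 0 < a ->
  (lebesgue_measure
    (`[0%R, (2 * pi)%R[ `&` [set t | (a <= normc (f (r%:C * expi t)))%R]) <=
    (2 * pi / a)%:E * circle_mean (fun t => normc (f (r%:C * expi t)))%R)%E.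
Proof.
move=> af r01 a0; pose u (t : R) : R := normc (f (r%:C * expi t)).
have pi2 : 0 < 2 * pi :> R by rewrite mulr_gt0// pi_gt0.
have u0 t : 0 <= u t by exact: normc_ge0.
have mu : measurable_fun `[0%R, (2 * pi)%R] u.
  apply: measurable_funTS; apply: continuous_measurable_fun.
  exact: continuous_circle.
move/measurable_EFinP in mu.
(* Markov's inequality is applied with the identity as its nondecreasing weight. *)
have idnd : {in `[0%E, +oo[%classic &, 
    {homo (@id (\bar R)) : x y / (x <= y)%E}} by [].
have := le_integral_comp_abse lebesgue_measure (measurable_itv _)
  (@measurable_id _ _ setT) (fun _ => id) idnd mu a0.
rewrite /circle_mean muleA -EFinM.
rewrite [X in (_ <= X)%E -> _](_ : _ =
  \int[lebesgue_measure]_(t in `[0%R, (2 * pi)%R]) (u t)%:E)%E; last first.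
  by apply: eq_integral => t _ /=; rewrite ger0_norm.
rewrite -lee_pdivlMl// => h.
apply: le_trans (le_trans _ h) _.
  apply: le_lebesgue_measure => t [/= tI au]; split => /=.
    by move: tI; rewrite !in_itv/= => /andP[-> /ltW ->].
  by rewrite lee_fin ger0_norm.
rewrite (_ : 2 * pi / a * (2 * pi)^-1 = a^-1); first exact: lexx.
by rewrite mulrAC divff ?mul1r ?lt0r_neq0.
Qed.

(** Horner's scheme: for |z| <= 1, multiplying by z does not increase the modulus, and adding c
    costs at most |c|. *)
Lemma horner_bounded_disc (R : rcfType) (p : {poly R[i]}) :
  exists M : R, forall z, normc z <= 1 -> normc p.[z] <= M.
Proof.
elim/poly_ind: p => [|p c [M pM]].
  by exists 0 => z _; rewrite horner0 normc0.
exists (M + normc c) => z z1; rewrite hornerMXaddC.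
apply: le_trans (le_normcD _ _) _; rewrite lerD2r normcM.
by apply: le_trans (pM z z1); rewrite ler_piMr// normc_ge0.
Qed.

Lemma real_normE (R : realType) (E : completeNormedModType R[i]) (g : E) :
  `|g| = (real_norm g)%:C.
Proof. by rewrite /real_norm RRe_real// normr_real. Qed.

Lemma real_norm_ge0 (R : realType) (E : completeNormedModType R[i]) (g : E) :
  0 <= real_norm g.
Proof. by rewrite -lecR -real_normE; exact: normr_ge0. Qed.

(** * Functions that are large on most of a circle *)

Section AnalyticFunctionSpace.
Context {R : realType} {E : completeNormedModType R[i]}.
Variable ev : E -> R[i] -> R[i].
Hypothesis E_analytic : analytic_function_space ev.

Let evD (a : R[i]) (g h : E) z :
  unit_disc z -> ev (a *: g + h) z = a * ev g z + ev h z.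
Proof. by case: E_analytic => + _ _; apply. Qed.

Let circle_sublevel (g : E) (r c : R) : set R :=
  `[0, 2 * pi[ `&` [set t | normc (ev g (r%:C * expi t)) <= c].

(** Where |h| <= c, the difference g - h has modulus at least a; by Chebyshev such t have measure at
    most 2 pi C ‖g - h‖ / a. *)
Lemma near_circle_sublevel_small (g : E) (r C c a e : R) :
  0 <= r < 1 -> 0 < C -> 0 < a -> 0 < e ->
  (forall h, (circle_mean (fun t => normc (ev h (r%:C * expi t)))%R
     <= (C * real_norm h)%:E)%E) ->
  (forall t, c + a <= normc (ev g (r%:C * expi t))) ->
  \forall h \near g, (lebesgue_measure (circle_sublevel h r c) <= e%:E)%E.
Proof.
move=> r01 C0 a0 e0 evC gca.
have pi2 : 0 < 2 * pi :> R by rewrite mulr_gt0// pi_gt0.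
(* Solves 2 pi C d / a = e. *)
pose d := e * a / (2 * pi * C).
have d0 : 0 < d by rewrite divr_gt0// mulr_gt0.
apply/nbhs_ballP; exists d%:C => /=; first by rewrite ltcR.
move=> h; rewrite -ball_normE /ball_/= real_normE ltcR => ghd /=.
have [_ _ analytic] := E_analytic.
have evB t : ev (g - h) (r%:C * expi t) =
    ev g (r%:C * expi t) - ev h (r%:C * expi t).
  by rewrite addrC -scaleN1r (evD _ _ _ (unit_disc_circle _ r01)) mulN1r addrC.
apply: (@le_trans _ _ (lebesgue_measure (`[0%R, (2 * pi)%R[ `&`
    [set t | (a <= normc (ev (g - h)%R (r%:C * expi t)))%R]))).
  apply: le_lebesgue_measure => t [/= tI hc]; split => //=; rewrite evB.
  have := ler_dist_normc (ev g (r%:C * expi t)) (ev h (r%:C * expi t)).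
  apply: le_trans; apply: le_trans (ler_norm _); have := gca t; lra.
apply: le_trans (circle_chebyshev (analytic _) r01 a0) _.
apply: (@le_trans _ _ ((2 * pi / a)%:E * (C * real_norm (g - h)%R)%:E)%E).
  by apply: (lee_wpmul2l _ (evC _)); rewrite lee_fin ltW// divr_gt0.
rewrite -EFinM lee_fin.
rewrite (_ : 2 * pi / a * (C * real_norm (g - h)) =
    real_norm (g - h) * (2 * pi * C) / a).
  by rewrite ler_pdivrMr// -ler_pdivlMr ?mulr_gt0 ?pi_gt0//; exact: ltW.
ring.
Qed.

Variables (r0 : R) (phi : R -> R).
Hypothesis r0_itv : 0 <= r0 < 1.
Hypothesis phi_gt0 : forall r : R, r0 <= r < 1 -> 0 < phi r.

(** The set V_n of the overview, with exceptional sets measured by Lebesgue measure in t, not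
    normalized. *)
Definition often_large (n : nat) : set E := [set g | exists r : R,
  [/\ r0 <= r, 1 - n.+1%:R^-1 < r < 1 &
    (lebesgue_measure (circle_sublevel g r (n%:R * phi r)) <= (n.+1%:R^-1)%:E)%E]].

Lemma circle_measure_limsup (g : E) : (forall n, often_large n g) ->
  circle_measure
      [set w | unit_circle w /\
         limf_esup (fun r : R => ((phi r)^-1 * normc (ev g (r%:C * w)))%:E) 1^'-
           = +oo%E]
      = 1%E.
Proof.
rewrite /often_large/= => /choice[x xP]; set S := [set w | _].
have pi2 : 0 < 2 * pi :> R by rewrite mulr_gt0// pi_gt0.
pose D : set R := `[0, 2 * pi[%classic.
have muD : lebesgue_measure D = (2 * pi)%:E.
  by rewrite lebesgue_measure_itv/= lte_fin pi2 oppr0 adde0.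
suff muS : lebesgue_measure (D `&` expi @^-1` S) = (2 * pi)%:E.
  by rewrite /circle_measure muS -EFinM mulVf// lt0r_neq0.
pose B n := circle_sublevel g (x n) (n%:R * phi (x n)).
pose Z N := \bigcap_(n in [set n | (N <= n)%N]) B n.
have Z0 N : lebesgue_measure (Z N) = 0%E.
  apply/eqP; rewrite eq_le measure_ge0 andbT.
  apply/lee_addgt0Pr => e e0; rewrite add0e.
  (* The index is at least N, so [Z N] lies in that [B n], and large enough that 1/(n+1) < e. *)
  have [_ _ muB] := xP (maxn N (Num.truncn e^-1)).
  apply: (le_trans _ (le_trans muB _)).
    by apply: le_lebesgue_measure; apply: bigcap_inf => /=; exact: leq_maxl.
  rewrite lee_fin -[leRHS]invrK lef_pV2 ?posrE ?invr_gt0//.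
  apply/ltW/(lt_le_trans (truncnS_gt _)); rewrite ler_nat ltnS; exact: leq_maxr.
(* A point outside every [Z N] escapes [B n] for infinitely many n, and there |g| > n phi at radius
   [x n]. *)
have DS : D `<=` (D `&` expi @^-1` S) `|` \bigcup_N Z N.
  move=> t tD; have [|tZ] := pselect ((\bigcup_N Z N) t); [by right|left].
  split => //=; split; first by rewrite /unit_circle/= norm_normc normc_expi.
  apply: (@limf_esup_at_left_pinfty _ _ _ x) => [n|m].
    by have [] := xP n.
  apply: contrapT => nm; apply: tZ; exists m => // n /= mn; split => //=.
  rewrite leNgt; apply/negP => lt; apply: nm; exists n => //.
  have [r0r /andP[_ r1] _] := xP n.
  by rewrite ler_pdivlMl ?phi_gt0 ?r0r// mulrC ltW.
apply/eqP; rewrite eq_le -{1 2}muD; apply/andP; split.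
  by apply: le_lebesgue_measure => t [].
apply: le_trans (le_lebesgue_measure DS) _.
apply: le_trans (lebesgue_measureU _ _) _.
by rewrite (lebesgue_measure_bigcup0 Z0) adde0.
Qed.

(** * Density of the interiors *)

Hypothesis E_poly : polynomials_dense ev.
Hypothesis E_L1 : L1_average_continuous ev.
Hypothesis phi_lim : phi r @[r --> 1^'-] --> +oo.
Variables (f : E) (r_ : nat -> R) (m : nat -> R).
Hypothesis r_itv : forall p, r0 <= r_ p < 1.
Hypothesis r_cvg : r_ @ \oo --> (1 : R).
Hypothesis m_min : forall p, is_minimum
  [set normc (ev f ((r_ p)%:C * w)) | w in unit_circle] (m p).
Hypothesis m_lim : (phi (r_ p))^-1 * m p @[p --> \oo] --> +oo.

Lemma phi_along_cvgy : phi (r_ p) @[p --> \oo] --> +oo.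
Proof.
apply: cvg_comp phi_lim => A /= [e e0 eA].
move/cvgrPdist_lt : r_cvg => /(_ _ e0); apply: filterS => p /= pe.
by apply: eA => //=; case/andP: (r_itv p).
Qed.

Lemma dense_interior_often_large (n : nat) : dense (often_large n)^°.
Proof.
move=> O /= O0 oO.
have [_ /(_ O O0 oO)[q [Oq [p qp]]]] := E_poly.
have /nbhs_ballP[d /=] : nbhs q O by exact: open_nbhs_nbhs.
rewrite ltcE/= => /andP[/eqP imd red] qd.
have nf := real_norm_ge0 f.
(* The added 1 makes ‖e f‖ < d strict and covers the case f = 0. *)
pose e := complex.Re d / (real_norm f + 1).
have e0 : 0 < e by rewrite divr_gt0// ltr_pwDr.
pose g := e%:C *: f + q.
exists g; split.
  apply: qd; rewrite -ball_normE /ball_/= opprD addrCA subrr addr0 normrN normrZ.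
  rewrite real_normE norm_normc normc_real (gtr0_norm e0) -rmorphM/= ltcE/= imd eqxx/=.
  by rewrite -mulrA gtr_pMr// mulrC ltr_pdivrMr ?mul1r ?ltrDl// ltr_pwDr.
have [M pM] := horner_bounded_disc p.
have [rho0 /andP[rho00 rho01] L1] := E_L1.
(* Of the n + 2 multiples of phi, one absorbs the polynomial, bounded by M <= phi, and one is the
   margin for the perturbation; n remain. *)
have /cvgryPge/(_ ((n%:R + 2) / e)) mA := m_lim.
have /cvgryPge/(_ M) phiM := phi_along_cvgy.
have /cvgrPdist_lt r1 := r_cvg.
have /r1 near_rho : 0 < 1 - rho0 by rewrite subr_gt0.
have /r1 near_1 : 0 < n.+1%:R^-1 :> R by rewrite invr_gt0.
have [N [/= mN phiN rhoN N1]] : exists N,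
  [/\ (n%:R + 2) / e <= (phi (r_ N))^-1 * m N,
    M <= phi (r_ N), `|1 - r_ N| < 1 - rho0 & `|1 - r_ N| < n.+1%:R^-1].
  near \oo => N; exists N; split; near: N => //.
have /andP[r0r r1'] := r_itv N.
have rr : 0 <= r_ N < 1 by rewrite r1' andbT (le_trans _ r0r)//; case/andP: r0_itv.
have ph0 := phi_gt0 (r_itv N).
rewrite gtr0_norm ?subr_gt0// in rhoN; rewrite gtr0_norm ?subr_gt0// in N1.
have [|C C0 evC] := L1 (r_ N); first by rewrite r1' andbT; lra.
have n0 : 0 < n.+1%:R^-1 :> R by rewrite invr_gt0.
have gl t : n%:R * phi (r_ N) + phi (r_ N) <= normc (ev g ((r_ N)%:C * expi t)).
  rewrite /g (evD _ _ _ (unit_disc_circle _ rr)).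
  have fm : m N <= normc (ev f ((r_ N)%:C * expi t)).
    have [_] := m_min N; apply; exists (expi t) => //.
    by rewrite /unit_circle/= norm_normc normc_expi.
  have qM : normc (ev q ((r_ N)%:C * expi t)) <= M.
    rewrite (qp _ (unit_disc_circle _ rr)); apply: pM.
    by rewrite normc_circle ?(ltW r1')//; case/andP: rr.
  have em : (n%:R + 2) * phi (r_ N) <= e * m N.
    by move: mN; rewrite ler_pdivrMr// -mulrA ler_pdivlMl// mulrC [m N * e]mulrC.
  have : e * m N <= normc (e%:C * ev f ((r_ N)%:C * expi t)).
    by rewrite normcM normc_real gtr0_norm// ler_pM2l.
  (* Reverse triangle inequality, from e f = (e f + q) - q. *)
  have := le_normcD (e%:C * ev f ((r_ N)%:C * expi t) + ev q ((r_ N)%:C * expi t))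
    (- ev q ((r_ N)%:C * expi t)).
  rewrite addrK normcN => AB eA; rewrite mulrDl in em.
  have lin (x y a b c k : R) :
      x + 2 * y <= a -> a <= b -> b <= c + k -> k <= M -> M <= y -> x + y <= c.
    by lra.
  exact: lin em eA AB qM phiN.
(* The same radius [r_ N] serves every h near g, so g is an interior point. *)
have := near_circle_sublevel_small rr C0 ph0 n0 evC gl.
apply: filterS => h hs; exists (r_ N); split => //.
by rewrite r1' andbT ltrBlDr -ltrBlDl.
Unshelve. all: by end_near. Qed.

End AnalyticFunctionSpace.

Theorem theorem3p10 (R : realType) (E : completeNormedModType R[i])
    (ev : E -> R[i] -> R[i]) (r0 : R) (phi : R -> R)
    (E_analytic : analytic_function_space ev)
    (E_poly : polynomials_dense ev)
    (E_L1 : L1_average_continuous ev)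
    (r0_itv : 0 <= r0 < 1)
    (phi_gt0 : forall r : R, r0 <= r < 1 -> 0 < phi r)
    (phi_incr : forall r s : R, r0 <= r -> r <= s -> s < 1 -> phi r <= phi s)
    (phi_cont : {within `[r0, 1[%classic, continuous phi})
    (phi_lim : phi r @[r --> 1^'-] --> +oo)
    (f_exists : exists (f : E) (r_ : nat -> R) (m : nat -> R),
      [/\ forall p, r0 <= r_ p < 1,
          r_ @ \oo --> (1 : R),
          forall p, is_minimum
            [set normc (ev f ((r_ p)%:C * w)) | w in unit_circle] (m p)
        & (phi (r_ p))^-1 * m p @[p --> \oo] --> +oo]) :
  residual [set g : E |
    circle_measure
      [set w | unit_circle w /\
         limf_esup (fun r : R => ((phi r)^-1 * normc (ev g (r%:C * w)))%:E) 1^'-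
           = +oo%E]
      = 1%E].
Proof.
have [f [r_ [m [r_itv r_cvg m_min m_lim]]]] := f_exists.
exists (\bigcap_n (often_large ev r0 phi n)^°).
  split.
    exists (fun n => (often_large ev r0 phi n)^°) => // n.
    exact: open_interior.
  apply: (@baire_complex R E) => n; first exact: open_interior.
  exact: (@dense_interior_often_large _ _ _ E_analytic _ _ r0_itv phi_gt0
    E_poly E_L1 phi_lim f r_ m r_itv r_cvg m_min m_lim).
move=> g gl; apply: (@circle_measure_limsup _ _ _ r0) => // n.
exact: interior_subset (gl n _).
Qed.
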